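(* Let $T$ be a compact metric space, let $\mu$ be a regular, nonatomic, $\sigma$-additive measure on the Borel $\sigma$-algebra $\mathcal{B}$ of $T$ with values in $[0,\infty)$, and let $X$ be a Banach lattice with order-continuous norm. Let $f:T\to X$ be (oH)-integrable, and assume that $X$ is an $L$-space, i.e. $\|x+y\|=\|x\|+\|y\|$ for all positive elements $x,y\in X$. Then $f$ is Bochner integrable with respect to $\mu$.
   Context: Let $d$ be the metric of $T$. A gage is any map $\gamma:T\to(0,\infty)$. A Henstock partition of $T$ is a finite family $\Pi=\{(E_i,t_i): i=1,\dots,k\}$, where the $E_i$ are pairwise disjoint Borel sets with union $T$ and the tags satisfy $t_i\in E_i$. $\Pi$ is $\gamma$-fine if $d(w,t_i)<\gamma(t_i)$ for every $w\in E_i$ and every $i$. Put $\sigma(f,\Pi)=\sum_{i=1}^k f(t_i)\mu(E_i)$. An $(o)$-sequence in $X$ is a decreasing sequence $(b_n)_n$ with $\inf_n b_n=0$. A function $f:T\to X$ is (oH)-integrable if there exist $J\in X$, an $(o)$-sequence $(b_n)_n$ in $X$ and a sequence $(\gamma_n)_n$ of gages such that for every $n$ and every $\gamma_n$-fine Henstock partition $\Pi$ of $T$ one has $|\sigma(f,\Pi)-J|\le b_n$. Bochner integrability has its usual meaning: $f$ is strongly $\mu$-measurable (a $\mu$-almost everywhere limit of simple functions) and $\int\|f\|\,d\mu<\infty$. *)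

(* Defs.v *)
From HB Require Import structures.
From mathcomp Require Import all_boot all_order all_algebra.
From mathcomp Require Import all_classical all_reals all_analysis.

Set Implicit Arguments.
Unset Strict Implicit.
Unset Printing Implicit Defensive.

Import Order.TTheory GRing.Theory Num.Theory.
Import numFieldNormedType.Exports.

Local Open Scope classical_set_scope.
Local Open Scope ring_scope.

(* Measurable types are pointed, hence T is a metric space with a point, that is,
   a nonempty one. *)
#[short(type="pmetricType")]
HB.structure Definition PointedMetric (R : realType) :=
  {T of Metric R T & isPointed T}.

Definition borel (R : realType) (T : pmetricType R) :=
  g_sigma_algebraType (@open T).

(* The order is a field of the class, not an instance of Order.Lattice: the
   library hierarchy has no join of Order.Lattice with normed modules, and one
   cannot be added after realDomainType. The last axiom is the lattice-norm
   axiom; `|x| denotes the norm, bl_join x (- x) the absolute value. *)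
HB.mixin Record isBanachLattice (R : realType) (X : Type)
    & CompleteNormedModule R X := {
  bl_le : rel X ;
  bl_join : X -> X -> X ;
  bl_meet : X -> X -> X ;
  bl_le_refl : reflexive bl_le ;
  bl_le_anti : antisymmetric bl_le ;
  bl_le_trans : transitive bl_le ;
  bl_joinP : forall x y z : X, bl_le (bl_join x y) z = bl_le x z && bl_le y z ;
  bl_meetP : forall x y z : X, bl_le z (bl_meet x y) = bl_le z x && bl_le z y ;
  bl_leD2r : forall x y z : X, bl_le x y -> bl_le (x + z) (y + z) ;
  bl_scale_ge0 : forall (a : R) (x : X), 0 <= a -> bl_le 0 x -> bl_le 0 (a *: x) ;
  bl_le_norm : forall x y : X,
    bl_le (bl_join x (- x)) (bl_join y (- y)) -> `|x| <= `|y| }.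

#[short(type="banachLatticeType")]
HB.structure Definition BanachLattice (R : realType) :=
  {X of CompleteNormedModule R X & isBanachLattice R X}.

Notation "x <=| y" := (bl_le x y) (at level 70, no associativity) : ring_scope.

Section banach_lattice.
Context {R : realType} (X : banachLatticeType R).

Definition labs (x : X) : X := bl_join x (- x).

Definition is_inf (A : set X) (m : X) :=
  (forall x, A x -> m <=| x) /\
  (forall y, (forall x, A x -> y <=| x) -> y <=| m).

Definition decreases_to0 (I : Type) (leI : I -> I -> Prop) (x : I -> X) :=
  (forall i j, leI i j -> x j <=| x i) /\ is_inf (range x) 0.

Definition directed (I : Type) (leI : I -> I -> Prop) :=
  [/\ inhabited I,
      forall i, leI i i,
      forall i j k, leI i j -> leI j k -> leI i k
    & forall i j, exists k, leI i k /\ leI j k].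

Definition order_continuous_norm :=
  forall (I : Type) (leI : I -> I -> Prop) (x : I -> X),
    directed leI -> decreases_to0 leI x ->
    forall e : R, 0 < e -> exists i0, forall i, leI i0 i -> `|x i| < e.

Definition L_space :=
  forall x y : X, 0 <=| x -> 0 <=| y -> `|x + y| = `|x| + `|y|.

Definition o_sequence (b : nat -> X) := decreases_to0 (fun m n => (m <= n)%N) b.

End banach_lattice.

Section measure_on_metric_space.
Context {R : realType} {T : pmetricType R}.
Variable mu : {finite_measure set (borel T) -> \bar R}.

Definition regular_measure :=
  forall A : set (borel T), measurable A -> forall e : R, 0 < e ->
    exists K U : set T, [/\ compact K, open U, K `<=` A, A `<=` U
                          & (mu (U `\` K) < e%:E)%E].

Definition nonatomic :=
  forall A : set (borel T), measurable A -> (0 < mu A)%E ->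
    exists B : set (borel T),
      [/\ measurable B, B `<=` A & (0 < mu B < mu A)%E].

Definition gage (g : T -> R) := forall t, 0 < g t.

Definition Henstock_partition (k : nat) (E : 'I_k -> set (borel T))
    (t : 'I_k -> T) :=
  [/\ forall i, measurable (E i), trivIset setT E, \bigcup_i E i = setT
    & forall i, E i (t i)].

Definition fine_partition (g : T -> R) (k : nat) (E : 'I_k -> set (borel T))
    (t : 'I_k -> T) :=
  forall i w, E i w -> mdist w (t i) < g (t i).

Section integrals.
Context {X : banachLatticeType R}.
Implicit Type f : T -> X.

(* mu is finite, so no information is lost by fine. *)
Definition Henstock_sum f (k : nat) (E : 'I_k -> set (borel T))
    (t : 'I_k -> T) : X :=
  \sum_(i < k) fine (mu (E i)) *: f (t i).

Definition oH_integrable f :=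
  exists (J : X) (b : nat -> X) (g : nat -> T -> R),
    [/\ o_sequence b, forall n, gage (g n)
      & forall n (k : nat) (E : 'I_k -> set (borel T)) (t : 'I_k -> T),
          Henstock_partition E t -> fine_partition (g n) E t ->
          labs (Henstock_sum f E t - J) <=| b n].

Definition simple_function (s : borel T -> X) :=
  finite_set (range s) /\ forall x : X, measurable (s @^-1` [set x]).

Definition strongly_measurable f :=
  exists s : nat -> borel T -> X, (forall n, simple_function (s n)) /\
    {ae mu, forall t, s n t @[n --> \oo] --> f t}.

(* For strongly measurable f, |f| is only equal mu-almost everywhere to a Borel
   function, so mu.-integrable (which requires Borel measurability) would be too
   strong. The integral of a nonnegative function is the supremum of the
   integrals of the simple functions below it; on functions measurable for the
   completion of mu it is the integral against that completion. *)
Definition Bochner_integrable f :=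
  strongly_measurable f /\ (\int[mu]_t `|f t|%:E < +oo)%E.

End integrals.
End measure_on_metric_space.

(* Main.v *)
Require Import Defs.
From HB Require Import structures.
From mathcomp Require Import all_boot all_order all_algebra.
From mathcomp Require Import all_classical all_reals all_analysis.
From mathcomp Require Import measurable_realfun.
Import Order.TTheory GRing.Theory Num.Theory.
Import numFieldNormedType.Exports.
Local Open Scope classical_set_scope.
Local Open Scope ring_scope.

(* Points are null, so a tag may be moved out of its cell and the Riemann sums
   are of McShane type. If u and v are two systems of gamma_n-fine tags of the same
   cells C_i, then exchanging u_i and v_i on any set of indices gives
   sum_i mu(C_i) |f(u_i) - f(v_i)| <= 2 b_n in X, and the L-space axiom turns this
   into sum_i mu(C_i) ||f(u_i) - f(v_i)|| <= 2 ||b_n||. Let s be the step function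
   of a gamma_n-fine partition. Cells of diameter < 1/k that contain a point x with
   ||f(x) - s(x)|| >= e and gamma_n(x) > 1/k may take such a point as tag, so their
   total measure is at most 2 ||b_n|| / e; as k grows this bounds the outer measure
   of {||f - s|| >= e}. Along a subsequence with ||b_n|| small, Borel-Cantelli gives
   s_n -> f almost everywhere. Taking the s_n fine for gamma_0 as well, their
   integrals differ from that of s_0 by at most 2 ||b_0||, and Fatou concludes. *)

(** * Absolute values and norms of finite sums in a Banach lattice *)

Section banach_lattice_theory.
Context {R : realType} {X : banachLatticeType R}.
Implicit Types x y z b : X.

Lemma bl_leD x y z u : x <=| y -> z <=| u -> x + z <=| y + u.
Proof.
move=> xy zu; apply: (@bl_le_trans _ _ (y + z)); first exact: bl_leD2r.
by rewrite ![y + _]addrC; exact: bl_leD2r.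
Qed.

Lemma bl_subr_ge0 x y : (0 <=| y - x) = (x <=| y).
Proof.
apply/idP/idP => [/(bl_leD2r _ _ x)|/(bl_leD2r _ _ (- x))].
  by rewrite add0r subrK.
by rewrite subrr.
Qed.

Lemma bl_leBrDr x y z : (x <=| y - z) = (x + z <=| y).
Proof. by rewrite -bl_subr_ge0 -[RHS]bl_subr_ge0 opprD addrA addrAC. Qed.

Lemma labs_le x b : (labs x <=| b) = (x <=| b) && (- x <=| b).
Proof. exact: bl_joinP. Qed.

Lemma le_labs x : x <=| labs x.
Proof. by have := bl_le_refl (labs x); rewrite labs_le => /andP[]. Qed.

Lemma labs_ge0 x : 0 <=| labs x.
Proof.
have := bl_le_refl (labs x); rewrite {1}labs_le => /andP[xl Nxl].
have := bl_leD _ _ _ _ xl Nxl; rewrite subrr => le0.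
(* Adding the bounds of [x] and [- x] by [labs x] gives that twice [labs x] is positive; it remains
   to halve. *)
have h0 : 0 <= 1 / 2 :> R by rewrite divr_ge0.
have : 0 <=| (1 / 2) *: (labs x + labs x) by exact: bl_scale_ge0.
by rewrite scalerDr -scalerDl -splitr scale1r.
Qed.

Lemma labs_id x : 0 <=| x -> labs x = x.
Proof.
move=> x0; apply: bl_le_anti; rewrite le_labs andbT labs_le bl_le_refl/=.
by rewrite -bl_subr_ge0 opprK -[X in X <=| _]addr0 bl_leD.
Qed.

Lemma norm_labs x : `|labs x| = `|x|.
Proof.
by apply/eqP; rewrite eq_le; apply/andP; split; apply: bl_le_norm;
  rewrite -!/(labs _) (labs_id (labs x)) ?bl_le_refl// labs_ge0.
Qed.

Lemma labs_norm_le x b : labs x <=| b -> `|x| <= `|b|.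
Proof.
move=> xb; apply: bl_le_norm; rewrite -/(labs x) -/(labs b).
exact: bl_le_trans xb (le_labs b).
Qed.

Lemma sumr_bl_ge0 (I : Type) (r : seq I) (x : I -> X) :
  (forall i, 0 <=| x i) -> 0 <=| \sum_(i <- r) x i.
Proof.
move=> x0; elim/big_ind: _ => // [|u v u0 v0]; first exact: bl_le_refl.
by rewrite -[X in X <=| _]addr0 bl_leD.
Qed.

(** Since [labs (x i)] is the join of [x i] and [- x i], a term bounded with both signs is bounded
    with its absolute value. The induction moves such terms one by one into [y], which is there for
    this purpose. *)
Lemma sum_labs_le (I : eqType) (r : seq I) (x : I -> X) y b : uniq r ->
  (forall e : I -> bool,
    y + \sum_(i <- r) (if e i then x i else - x i) <=| b) ->
  y + \sum_(i <- r) labs (x i) <=| b.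
Proof.
elim: r y => [|i r IH] y; first by move=> _ /(_ (fun=> true)); rewrite !big_nil.
rewrite cons_uniq => /andP[ir ur] yb.
rewrite big_cons addrA; apply: IH => // e.
rewrite addrAC addrC -bl_leBrDr labs_le !bl_leBrDr.
(* As [i] does not occur in [r], its sign [c] can be chosen independently of the signs [e] on
   [r]. *)
have E c :
    \sum_(j <- i :: r) (if (if j == i then c else e j) then x j else - x j) =
    (if c then x i else - x i) +
    \sum_(j <- r) (if e j then x j else - x j).
  rewrite big_cons eqxx; congr (_ + _); apply: eq_big_seq => j jr.
  by case: eqP => // ji; rewrite -ji jr in ir.
apply/andP; split.
  by have := yb (fun j => if j == i then true else e j); rewrite E addrCA.
by have := yb (fun j => if j == i then false else e j); rewrite E addrCA.
Qed.

Lemma L_space_sum (I : Type) (r : seq I) (x : I -> X) : L_space X ->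
  (forall i, 0 <=| x i) -> `|\sum_(i <- r) x i| = \sum_(i <- r) `|x i|.
Proof.
move=> LX x0; elim: r => [|i r IH]; first by rewrite !big_nil normr0.
by rewrite !big_cons LX ?IH//; exact: sumr_bl_ge0.
Qed.

(** The signed sums together bound the sum of the absolute values in the order of [X]. The lattice
    norm is monotone on positive elements, and in an L-space it is additive there. *)
Lemma L_space_sum_norm_le (I : finType) (x : I -> X) b : L_space X ->
  (forall e : I -> bool, \sum_i (if e i then x i else - x i) <=| b) ->
  \sum_i `|x i| <= `|b|.
Proof.
move=> LX xb; under eq_bigr do rewrite -norm_labs.
rewrite -L_space_sum//; last by move=> i; exact: labs_ge0.
apply: labs_norm_le; rewrite labs_id; last first.
  by apply: sumr_bl_ge0 => i; exact: labs_ge0.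
rewrite -[X in X <=| _]add0r; apply: sum_labs_le; first exact: index_enum_uniq.
by move=> e; rewrite add0r.
Qed.

Lemma o_sequence_norm_lt (b : nat -> X) : order_continuous_norm X ->
  o_sequence b -> forall e : R, 0 < e -> exists n, `|b n| < e.
Proof.
move=> oc ob e e0; have [] := oc nat (fun m n => (m <= n)%N) b _ ob e e0.
  split=> [|i|i j k|i j]; first exact: (inhabits 0%N).
  - exact: leqnn.
  - exact: leq_trans.
  - by exists (maxn i j); rewrite leq_maxl leq_maxr.
by move=> n /(_ n (leqnn n)) ?; exists n.
Qed.

End banach_lattice_theory.

(** * Null points, and Riemann sums with tags outside their cells *)

Section tagged_families.
Context {R : realType} {T : pmetricType R}.
Variable mu : {finite_measure set (borel T) -> \bar R}.
Hypothesis nonatomic_mu : nonatomic mu.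

Lemma borel_open (A : set T) : open A -> measurable (A : set (borel T)).
Proof. exact: sub_sigma_algebra. Qed.

Lemma borel_set1 (x : T) : measurable ([set x] : set (borel T)).
Proof.
rewrite -[[set x]]setCK; apply: measurableC; apply: borel_open.
apply: closed_openC; apply: accessible_closed_set1.
exact/hausdorff_accessible/metric_hausdorff.
Qed.

(** A singleton has no subset other than itself and the empty set, hence none of intermediate
    measure. *)
Lemma nonatomic_set1 (x : T) : mu [set x] = 0.
Proof.
apply/eqP; rewrite eq_le measure_ge0 andbT leNgt; apply/negP => x0.
have [B [mB Bx /andP[B0 Blt]]] := nonatomic_mu _ (borel_set1 x) x0.
have [BE|/set0P[y By]] := eqVneq B set0.
  by move: B0; rewrite BE measure0 ltxx.
move: Blt; suff -> : B = [set x] by rewrite ltxx.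
by apply/seteqP; split=> // _ ->; rewrite -(Bx _ By).
Qed.

Lemma nonatomic_finite (A : set T) : finite_set A ->
  measurable (A : set (borel T)) /\ mu A = 0.
Proof.
move=> fA.
have AE : A = \bigcup_(x in A) [set x] by rewrite bigcup_imset1 image_id.
have mA : measurable (A : set (borel T)).
  by rewrite AE; apply: fin_bigcup_measurable => // x _; exact: borel_set1.
split => //; rewrite AE measure_fin_bigcup//.
- by rewrite fsbig1// => x _; exact: nonatomic_set1.
- by move=> x y _ _ [z [-> ->]].
- by move=> x _; exact: borel_set1.
Qed.

Definition Borel_partition {I : Type} (C : I -> set (borel T)) :=
  [/\ forall i, measurable (C i), trivIset setT C & \bigcup_i C i = setT].

Lemma Borel_partitionI (I K : Type) (C : I -> set (borel T))
    (D : K -> set (borel T)) : Borel_partition C -> Borel_partition D ->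
  Borel_partition (fun p : I * K => C p.1 `&` D p.2).
Proof.
move=> [mC tC CT] [mD tD DT]; split.
- by move=> p; exact: measurableI.
- move=> [i j] [i' j'] _ _ [x [[/= Ci Dj] [/= Ci' Dj']]].
  by congr pair; [apply: tC|apply: tD] => //; exists x.
- apply/seteqP; split => // x _.
  have [i _ Ci] : (\bigcup_i C i) x by rewrite CT.
  have [j _ Dj] : (\bigcup_i D i) x by rewrite DT.
  by exists (i, j).
Qed.

(** Unlike in a Henstock partition, [w i] need not belong to [C i], and tags may repeat. *)
Definition fine_tags (g : T -> R) {I : Type} (C : I -> set (borel T))
    (w : I -> T) :=
  forall i x, C i x -> mdist x (w i) < g (w i).

Lemma measure_finType_bigcup (I : finType) (P : pred I)
    (C : I -> set (borel T)) :
  (forall i, measurable (C i)) -> trivIset setT C ->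
  fine (mu (\bigcup_(i in [set` P]) C i)) = \sum_(i | P i) fine (mu (C i)).
Proof.
move=> mC tC; rewrite measure_fin_bigcup//; last exact: sub_trivIset tC.
rewrite -(bigfs _ (index_enum_uniq I))//; last first.
  by move=> i _; rewrite mem_index_enum.
apply: EFin_inj; rewrite fineK; last first.
  by rewrite sum_fin_num; apply/allP => _ /mapP[i _ ->]; exact: fin_num_measure.
by rewrite -sumEFin; apply: eq_bigr => i _; rewrite fineK// fin_num_measure.
Qed.

Context {X : banachLatticeType R}.
Implicit Type f : T -> X.

(* Points are null, so tags need not lie in their cells: cells sharing a tag are
   merged, and the finitely many tags are redistributed. *)
Lemma McShane_sum f (J b : X) (g : T -> R) :
    (forall (k : nat) (E : 'I_k -> set (borel T)) (t : 'I_k -> T),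
      Henstock_partition E t -> fine_partition g E t ->
      labs (Henstock_sum mu f E t - J) <=| b) ->
    gage g ->
  forall (I : finType) (C : I -> set (borel T)) (w : I -> T),
    Borel_partition C -> fine_tags g C w ->
    labs (\sum_i fine (mu (C i)) *: f (w i) - J) <=| b.
Proof.
move=> fJb g0 I C w [mC tC CT] gw.
pose s := undup (codom w).
have ws i : (index (w i) s < size s)%N by rewrite index_mem mem_undup codom_f.
pose t (j : 'I_(size s)) := nth point s j.
pose p i := Ordinal (ws i).
have tp i : t (p i) = w i by rewrite /t/= nth_index// mem_undup codom_f.
have tI : injective t.
  by move=> j k /eqP; rewrite nth_uniq ?undup_uniq// => /eqP/ord_inj.
have pE i j : (p i == j) = (w i == t j) by rewrite -tp (inj_eq tI).
have [mS S0] := nonatomic_finite _ (finite_seq s).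
have st j : t j \in s by exact: mem_nth.
pose D j := \bigcup_(i in [set` (fun i => p i == j)]) C i.
have mD j : measurable (D j).
  by apply: fin_bigcup_measurable => // i _; exact: mC.
(* All tags are removed from the merged cell and only its own is put back, so each tag lies in
   exactly one cell; the change is by a finite, hence null, set. *)
pose E j := (D j `\` [set` s]) `|` [set t j].
have mE j : measurable (E j).
  by apply: measurableU; [exact: measurableD|exact: borel_set1].
have muE j : mu (E j) = mu (D j).
  rewrite -(measureU0 (mE j) mS S0) -[RHS](measureU0 (mD j) mS S0).
  congr (mu _); apply/seteqP; split => x.
    by move=> [[[Dx _]|->]|sx]; [left|right; exact: st|right].
  move=> [Dx|sx]; last by right.
  by have [xs|xs] := pselect (x \in s); [right|left; left].
have HE : Henstock_partition E t.
  split => // [|| j]; last by right.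
  - move=> j k _ _
      [x [[[[i /= /eqP ij Cx] nx]|xj] [[[i' /= /eqP ij' Cx'] nx']|xk]]].
    + by rewrite -ij -ij'; congr p; apply: tC => //; exists x.
    + by case: nx; rewrite /= xk; exact: st.
    + by case: nx'; rewrite /= xj; exact: st.
    + by apply: tI; rewrite -xj -xk.
  - apply/seteqP; split => // x _.
    have [xs|xs] := pselect (x \in s).
      have xw : (index x s < size s)%N by rewrite index_mem.
      by exists (Ordinal xw) => //; right; rewrite /t/= nth_index.
    have [i _ Cx] : (\bigcup_i C i) x by rewrite CT.
    exists (p i) => //; left; split => //. exists i => //; exact: eqxx.
have gE : fine_partition g E t.
  move=> j x [[[i /= /eqP <- Cx] _]|->]; first by rewrite tp; exact: gw Cx.
  by rewrite mdistxx g0.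
suff <- : Henstock_sum mu f E t = \sum_i fine (mu (C i)) *: f (w i).
  exact: fJb.
rewrite /Henstock_sum (partition_big p xpredT)//=; apply: eq_bigr => j _.
rewrite muE measure_finType_bigcup// scaler_suml; apply: eq_bigr => i.
by rewrite pE => /eqP ->.
Qed.

End tagged_families.

(** * Existence of fine partitions of a compact space *)

Section fine_partitions.
Context {R : realType} {T : pmetricType R}.

(** Finitely many open sets, the interiors of the balls of radius [g x], cover [T]; each is
    diminished by the earlier ones. This may remove a centre from its own cell, which [fine_tags]
    permits. *)
Lemma fine_partition_exists (g : T -> R) : compact [set: T] -> gage g ->
  exists (k : nat) (E : 'I_k -> set (borel T)) (t : 'I_k -> T),
    Borel_partition E /\ fine_tags g E t.
Proof.
move=> + g0; rewrite compact_cover.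
pose U x := interior (ball x (g x)).
move=> /(_ T setT U) [x _|x _|F _ TF]; first exact: open_interior.
  by exists x => //; apply: nbhsx_ballx; exact: g0.
pose s := finmap.enum_fset F.
pose E (i : 'I_(size s)) : set (borel T) :=
  U (nth point s i) `\`
  \bigcup_(j in [set j : 'I_(size s) | (j < i)%N]) U (nth point s j).
have mU x : measurable (U x : set (borel T)).
  by apply: borel_open; exact: open_interior.
exists (size s), E, (fun i => nth point s i); split; last first.
  move=> i x [/interior_subset + _]; rewrite ballEmdist/=.
  by rewrite metric_sym.
split.
- move=> i; apply: measurableD => //.
  by apply: fin_bigcup_measurable => // j _.
- have EU (i j : 'I_(size s)) x : (i < j)%N -> E i x -> E j x -> False.
    by move=> ij [Ui _] [_]; apply; exists i.
  move=> i j _ _ [x [Ei Ej]]; apply/ord_inj; case: (ltngtP i j) => // ij.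
    by case: (EU _ _ _ ij Ei Ej).
  by case: (EU _ _ _ ij Ej Ei).
- apply/seteqP; split => // x _; have [y /= yF Uy] := TF x I.
  (* The first set of the cover that contains [x] gives the cell of [x]. *)
  pose q := fun y => `[< U y x >].
  have hq : has q s by apply/hasP; exists y => //; apply/asboolP.
  have iq : (find q s < size s)%N by rewrite -has_find.
  exists (Ordinal iq) => //; split => /=.
    by have /asboolP := nth_find point hq.
  move=> [j /= ji Uj]; have := before_find point ji.
  by move/asboolP.
Qed.
End fine_partitions.

(** * Step functions over a finite Borel partition and their integrals *)

Section step_functions.
Context {R : realType} {T : pmetricType R} {X : normedModType R}.
Variables (I : finType) (E : I -> set (borel T)).
Hypothesis partE : Borel_partition E.

(** The value 0 is a default, never taken when the cells cover [T]. *)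
Definition step_function (y : I -> X) (x : T) : X :=
  if [pick i | `[< E i x >]] is Some i then y i else 0.

Lemma stepE y i x : E i x -> step_function y x = y i.
Proof.
case: partE => _ tE _ Ei; rewrite /step_function.
case: pickP => [j /asboolP Ej|/(_ i)].
  by congr y; apply: tE => //; exists x.
by move/asboolP.
Qed.

Lemma step_cell x : exists i, E i x.
Proof.
case: partE => _ _ ET; have [i _ Ei] : (\bigcup_i E i) x by rewrite ET.
by exists i.
Qed.

Lemma preimage_step y (B : set X) :
  step_function y @^-1` B = \bigcup_(i in [set i | B (y i)]) E i.
Proof.
apply/seteqP; split => x /=.
  by have [i Ei] := step_cell x; rewrite (stepE _ _ _ Ei) => By; exists i.
by move=> [i /= By Ei]; rewrite (stepE _ _ _ Ei).
Qed.

Lemma finite_range_step y : finite_set (range (step_function y)).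
Proof.
apply: (sub_finite_set _ (finite_image y (@finite_finset _ setT))).
move=> _ [x _ <-]; have [i Ei] := step_cell x; rewrite (stepE _ _ _ Ei).
by exists i.
Qed.

Lemma measurable_preimage_step y (B : set X) :
  measurable (step_function y @^-1` B : set (borel T)).
Proof.
case: partE => mE _ _; rewrite preimage_step.
by apply: fin_bigcup_measurable => // i _; exact: mE.
Qed.

Lemma norm_stepE y x :
  (`|step_function y x|%:E = \sum_i (`|y i|%:E * (\1_(E i) x)%:E))%E.
Proof.
have [i Ei] := step_cell x; rewrite (stepE _ _ _ Ei) (bigD1 i)//=.
rewrite indicE mem_set//.
rewrite mule1 big1 ?adde0// => j ji; rewrite indicE memNset ?mule0// => Ej.
by case: partE => _ tE _; case/eqP: ji; apply: tE => //; exists x.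
Qed.

Lemma measurable_norm_step y :
  measurable_fun setT (fun x : borel T => `|step_function y x|%:E).
Proof.
case: partE => mE _ _; have -> : (fun x : borel T => `|step_function y x|%:E) =
    fun x => (\sum_i (`|y i|%:E * (\1_(E i) x)%:E))%E.
  by apply/funext => x; exact: norm_stepE.
apply: emeasurable_sum => i; apply: emeasurable_funM => //.
by apply/measurable_EFinP; exact: measurable_indic.
Qed.

Lemma integral_norm_step (mu : {measure set (borel T) -> \bar R}) y :
  (\int[mu]_x `|step_function y x|%:E = \sum_i (`|y i|%:E * mu (E i)))%E.
Proof.
case: partE => mE _ _; under eq_integral do rewrite norm_stepE.
rewrite ge0_integral_sum//; last first.
  move=> i; apply: emeasurable_funM => //.
  by apply/measurable_EFinP; exact: measurable_indic.
apply: eq_bigr => i _; rewrite ge0_integralZl//; last first.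
  by apply/measurable_EFinP; exact: measurable_indic.
by rewrite integral_indic// setIT.
Qed.
End step_functions.

Arguments step_function {R T X I} E y x.
Arguments stepE {R T X I E} partE y {i x} _.
Arguments step_cell {R T I E} partE x.
Arguments norm_stepE {R T X I E} partE y x.
Arguments measurable_norm_step {R T X I E} partE y.
Arguments integral_norm_step {R T X I E} partE mu y.
Arguments finite_range_step {R T X I E} partE y.
Arguments measurable_preimage_step {R T X I E} partE y B.

(** * Exchange of tags and a weak-type estimate for the step function *)

Section Henstock_lemma.
Context {R : realType} {T : pmetricType R} {X : banachLatticeType R}.
Variables (mu : {finite_measure set (borel T) -> \bar R}) (f : T -> X).
Variables (J b : X) (g : T -> R).
Hypotheses (compactT : compact [set: T]) (LX : L_space X).
Hypothesis fJb : forall (I : finType) (C : I -> set (borel T)) (w : I -> T),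
  Borel_partition C -> fine_tags g C w ->
  labs (\sum_i fine (mu (C i)) *: f (w i) - J) <=| b.

(* Exchanging the tags u and v on an arbitrary set of cells bounds every signed
   sum, hence the sum of the absolute values, by 2b; in an L-space the norm of
   this sum is the sum of the norms. *)
Lemma Henstock_norm (I : finType) (C : I -> set (borel T)) (u v : I -> T) :
    Borel_partition C -> fine_tags g C u -> fine_tags g C v ->
  \sum_i fine (mu (C i)) * `|f (u i) - f (v i)| <= 2 * `|b|.
Proof.
move=> PC gu gv.
have mC i : 0 <= fine (mu (C i)) by rewrite fine_ge0.
have -> : 2 * `|b| = `|b + b|.
  have -> : b + b = 2%:R *: b by rewrite scaler_nat mulr2n.
  by rewrite normrZ ger0_norm.
under eq_bigr => i _ do rewrite -[X in X * _](ger0_norm (mC i)) -normrZ.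
apply: L_space_sum_norm_le => // e.
pose w i := if e i then u i else v i; pose w' i := if e i then v i else u i.
have gw : fine_tags g C w
  by move=> i x; rewrite /w; case: ifP => _; [exact: gu|exact: gv].
have gw' : fine_tags g C w'
  by move=> i x; rewrite /w'; case: ifP => _; [exact: gv|exact: gu].
(* Adding the upper bound for the sum with tags [w] to the lower bound for the one with the opposite
   choice [w'] cancels [J]. *)
have := fJb _ _ _ PC gw; rewrite labs_le => /andP[+ _].
have := fJb _ _ _ PC gw'; rewrite labs_le => /andP[_ +] => h' h.
have := bl_leD _ _ _ _ h h'; rewrite opprB addrA subrK -sumrB.
congr (_ <=| _); apply: eq_bigr => i _; rewrite -scalerBr /w /w'.
by case: ifP => // _; rewrite -scalerN opprB.
Qed.

(** A Markov inequality for the exchange estimate. As [f] is not known to be measurable at this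
    stage, the exceptional set is only enclosed in a Borel set. *)
Lemma Henstock_cover (k : nat) (E : 'I_k -> set (borel T)) (t : 'I_k -> T)
    (e : R) : 0 < e -> Borel_partition E -> fine_tags g E t -> gage g ->
  exists V : set (borel T), [/\ measurable V,
    [set x | e <= `|f x - step_function E (f \o t) x|] `<=` V
    & (mu V <= (2 * `|b| / e)%:E)%E].
Proof.
move=> e0 PE gt g0.
pose N := [set x | e <= `|f x - step_function E (f \o t) x|].
suff /choice[V VP] : forall n, exists V : set (borel T), [/\ measurable V,
    N `&` [set x | n.+1%:R^-1 < g x] `<=` V & (mu V <= (2 * `|b| / e)%:E)%E].
  have mV n : measurable (V n) by have [] := VP n.
  (* The sets [V n] need not increase, but the intersections of their tails do. They keep the bound
     on the measure, and it passes to their union by continuity from below. *)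
  pose W n := \bigcap_(i in [set i | (n <= i)%N]) V i.
  have mW n : measurable (W n).
    by apply: bigcap_measurable => //; exists n => /=.
  exists (\bigcup_n W n); split; first exact: bigcup_measurable.
    move=> x Nx; have [n _ nx] : exists2 n, True & n.+1%:R^-1 < g x.
      have /ltr_add_invr[n] := g0 x; rewrite add0r => ?; by exists n.
    exists n => // i /= ni; have [_ + _] := VP i; apply; split => //=.
    by apply: le_lt_trans nx; rewrite lef_pV2 ?posrE// ler_nat.
  have cW : (mu \o W) x @[x --> \oo] --> mu (\bigcup_n W n).
    apply: nondecreasing_cvg_mu => //; first exact: bigcup_measurable.
    move=> m n mn; rewrite subsetEset => x Wx i /= ni; apply: Wx => /=.
    exact: leq_trans ni.
  rewrite -(cvg_lim _ cW)//; apply: lime_le.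
    by apply/cvg_ex; eexists; exact: cW.
  apply: nearW => n /=; have [_ _] := VP n; apply: le_trans.
  by apply: le_measure; rewrite ?inE//; apply: bigcap_inf => /=.
(* Cells of [D] lie within [d] of a centre, so two points of one cell are closer than [2 * d], which
   is less than [g] at any point chosen from [S p]. *)
move=> n; pose d : R := n.+1%:R^-1 / 2.
have d0 : 0 < d by rewrite divr_gt0.
have [m [D [c [PD dD]]]] := fine_partition_exists (fun=> d) compactT (fun=> d0).
pose C (p : 'I_k * 'I_m) : set (borel T) := E p.1 `&` D p.2.
have PC : Borel_partition C := Borel_partitionI _ _ _ _ PE PD.
pose S p := [set u | [/\ C p u, e <= `|f u - f (t p.1)| & n.+1%:R^-1 < g u]].
(* Cells without a bad point keep the tag of [E] and contribute 0 to the exchange sum. *)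
pose u p := xget (t p.1) (S p).
pose P p := `[< S p !=set0 >].
have uP p : P p -> S p (u p) by move=> /asboolP[y Sy]; exact: xgetI Sy.
have gv : fine_tags g C (fun p => t p.1) by move=> p x [Ex _]; exact: gt Ex.
have gu : fine_tags g C u.
  move=> p x Cx; rewrite /u; case: xgetP => [y yu Sy|_]; last exact: gv Cx.
  have [Cy _] := Sy; apply: lt_trans.
  apply: le_lt_trans (metric_triangle x (c p.2) y) _.
  rewrite [X in _ < X]splitr ltrD//; last rewrite metric_sym.
    by case: Cx => _; exact: dD.
  by case: Cy => _; exact: dD.
exists (\bigcup_(p in [set` P]) C p); have [mC tC CT] := PC; split.
- by apply: fin_bigcup_measurable => // p _; exact: mC.
- move=> x [Nx gx].
  have [p _ Cx] : (\bigcup_i C i) x by rewrite CT.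
  exists p => //; apply/asboolP; exists x; split => //.
  by move: Nx; rewrite /N/= (stepE PE _ (proj1 Cx)).
have mP : measurable (\bigcup_(p in [set` P]) C p).
  by apply: fin_bigcup_measurable => // p _; exact: mC.
rewrite -[mu _]fineK ?fin_num_measure// lee_fin ler_pdivlMr//.
(* On each cell selected by [P] the exchanged values differ by at least [e] in norm. *)
rewrite measure_finType_bigcup// mulr_suml.
apply: le_trans (Henstock_norm _ _ _ _ PC gu gv).
rewrite [leLHS]big_mkcond/=; apply: ler_sum => p _.
case: ifP => [/uP[_ eu _]|_]; last by rewrite mulr_ge0// fine_ge0.
by rewrite ler_wpM2l// fine_ge0.
Qed.

End Henstock_lemma.

(** * Almost everywhere approximation with bounded integrals, and Bochner integrability *)

Section oH_integrable_L_space.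
Context {R : realType} {T : pmetricType R} {X : banachLatticeType R}.
Variables (mu : {finite_measure set (borel T) -> \bar R}) (f : T -> X).
Hypotheses (compactT : compact [set: T]) (nonatomic_mu : nonatomic mu).
Hypotheses (ocX : order_continuous_norm X) (LX : L_space X).
Hypothesis oHf : oH_integrable mu f.

Lemma oH_approximation : exists (s : nat -> borel T -> X) (M : R),
  [/\ forall n, simple_function (s n),
      {ae mu, forall t, s n t @[n --> \oo] --> f t},
      forall n, measurable_fun setT (fun x => `|s n x|%:E)
    & forall n, (\int[mu]_x `|s n x|%:E <= M%:E)%E].
Proof.
case: oHf => J [b [g [ob g0 gP]]].
have MS n := McShane_sum mu nonatomic_mu f J (b n) (g n) (gP n) (g0 n).
pose d n : R := 1 / (2 ^ n.+1)%:R.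
have d0 n : 0 < d n by rewrite divr_gt0// ltr0n expn_gt0.
(* The threshold makes the measure bound [2 * |b| / d n] of the exceptional set at most [d n], a
   summable sequence. *)
have /choice[N NP] n : exists m, `|b m| < d n * d n / 2.
  by apply: o_sequence_norm_lt => //; rewrite divr_gt0// mulr_gt0.
(* Fineness for [g (N n)] serves the convergence, fineness for [g 0] the uniform bound on the
   integrals. *)
pose h n x := Num.min (g 0%N x) (g (N n) x).
have h0 n : gage (h n) by move=> x; rewrite /h lt_min g0 g0.
have /choice[S SP] n :
  exists S : {k & (('I_k -> set (borel T)) * ('I_k -> T))%type},
    Borel_partition (projT2 S).1 /\ fine_tags (h n) (projT2 S).1 (projT2 S).2.
  have [k [E [t [PE Et]]]] := fine_partition_exists (h n) compactT (h0 n).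
  by exists (existT _ k (E, t)).
pose k n := projT1 (S n).
pose E n : 'I_(k n) -> set (borel T) := (projT2 (S n)).1.
pose t n : 'I_(k n) -> T := (projT2 (S n)).2.
have PE n : Borel_partition (E n) by have [] := SP n.
have tg n : fine_tags (g 0%N) (E n) (t n).
  by move=> i x Ex; have [_ /(_ i x Ex)] := SP n; rewrite /h lt_min => /andP[].
have tgN n : fine_tags (g (N n)) (E n) (t n).
  by move=> i x Ex; have [_ /(_ i x Ex)] := SP n; rewrite /h lt_min => /andP[].
pose s n : borel T -> X := step_function (E n) (f \o t n).
have ms n : measurable_fun setT (fun x => `|s n x|%:E).
  exact: measurable_norm_step (PE n) _.
have /choice[V VP] n : exists V : set (borel T), [/\ measurable V,
    [set x | d n <= `|f x - s n x|] `<=` V & (mu V <= (d n)%:E)%E].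
  have [V [mV fV muV]] := Henstock_cover mu f J (b (N n)) (g (N n)) compactT LX
    (MS _) _ _ _ _ (d0 n) (PE n) (tgN n) (g0 _).
  exists V; split => //; apply: le_trans muV _; rewrite lee_fin ler_pdivrMr//.
  by rewrite mulrC -ler_pdivlMr// ltW// NP.
have mV n : measurable (V n) by have [] := VP n.
(* Borel-Cantelli: outside this null set, [f] and [s n] differ by less than [d n] for all large
   [n]. *)
have V0 : mu (lim_sup_set V) = 0.
  apply: lim_sup_set_cvg0 => //.
  apply: (@le_lt_trans _ _ (\sum_(n <oo) (d n)%:E)%E).
    by apply: lee_nneseries => // n _; have [] := VP n.
  apply: (@le_lt_trans _ _ 1%:E); last exact: ltry.
  exact: epsilon_trick0.
pose K := (\int[mu]_x `|s 0%N x|%:E)%E.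
pose M := fine K + 2 * `|b 0%N|.
have Kfin : K \is a fin_num.
  rewrite /K (integral_norm_step (PE 0%N)) sum_fin_num.
  apply/allP => _ /mapP[i _ ->]; have [mE _ _] := PE 0%N.
  by apply: fin_numM => //; exact: fin_num_measure.
exists s, M; split => //.
- move=> n; split; first exact: finite_range_step (PE n) _.
  by move=> x; exact: measurable_preimage_step (PE n) _ _.
- exists (lim_sup_set V); split => //.
    by apply: bigcap_measurable => // n _; exact: bigcup_measurable.
  apply: subsetCl => x /= Vx.
  have [n xV] : exists n, forall m, (n <= m)%N -> ~ V m x.
    apply: contrapT => /forallNP nV; apply: Vx => n _.
    have /existsNP[m /not_implyP[nm /contrapT Vm]] := nV n.
    by exists m.
  apply/cvgrPdist_lt => e e0.
  have dcvg : d n @[n --> \oo] --> 0.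
    have -> : d = geometric 2^-1 2^-1.
      by apply/funext => i; rewrite /d/= -exprS exprVn -natrX div1r.
    by apply: cvg_geometric; rewrite ger0_norm ?invr_ge0// invf_lt1 ?ltr1n.
  near=> m; apply: (@lt_trans _ _ (d m)); last first.
    by near: m; exact: cvgr_lt dcvg _ e0.
  have [_ Vm _] := VP m; rewrite ltNge; apply/negP => /Vm.
  by apply: xV; near: m; exact: nbhs_infty_ge.
- move=> n; pose C (p : 'I_(k 0%N) * 'I_(k n)) := E 0%N p.1 `&` E n p.2.
  have PC : Borel_partition C := Borel_partitionI _ _ _ _ (PE 0%N) (PE n).
  (* On the common refinement [r] represents [s 0 - s n]. Both families of tags are fine for [g 0],
     so the exchange estimate bounds the integral of its norm by twice the norm of [b 0]. *)
  pose r := step_function C (fun p => f (t 0%N p.1) - f (t n p.2)).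
  have mr : measurable_fun setT (fun x : borel T => `|r x|%:E).
    exact: measurable_norm_step PC _.
  apply: (@le_trans _ _ (\int[mu]_x (`|s 0%N x|%:E + `|r x|%:E))%E).
    apply: ge0_le_integral => //; first exact: emeasurable_funD.
    move=> x _; rewrite -EFinD lee_fin.
    have [[i j] Cx] := step_cell PC x; have [Ei Ej] := Cx.
    rewrite /s /r (stepE PC _ Cx) (stepE (PE 0%N) _ Ei) (stepE (PE n) _ Ej)/=.
    by rewrite -lerBlDl distrC lerB_dist.
  rewrite ge0_integralD//= /M EFinD fineK//; apply: leeD => //.
  rewrite (integral_norm_step PC).
  have mC : forall p, measurable (C p) by case: PC.
  have -> : (\sum_p (`|f (t 0%N p.1) - f (t n p.2)|%:E * mu (C p)) =
      (\sum_p fine (mu (C p)) * `|f (t 0%N p.1) - f (t n p.2)|)%:E)%E.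
    rewrite -sumEFin; apply: eq_bigr => p _.
    by rewrite EFinM fineK ?fin_num_measure// muleC.
  rewrite lee_fin.
  apply: (Henstock_norm mu f J (b 0%N) (g 0%N) LX (MS 0%N) _ _
    (fun p => t 0%N p.1) (fun p => t n p.2) PC).
    by move=> p x [Ex _]; exact: tg Ex.
  by move=> p x [_ Ex]; exact: tg Ex.
Unshelve. all: by end_near. Qed.

Import HBNNSimple.

Lemma oH_integrable_Bochner : Bochner_integrable mu f.
Proof.
have [s [M [ss sf ms sM]]] := oH_approximation.
split; first by exists s.
apply: (@le_lt_trans _ _ M%:E); last exact: ltry.
(* The norm of [f] need not be Borel, so each simple [h] below it is compared with the Borel
   function [F], the lower limit of the norms of [s n], which equals the norm of [f] almost
   everywhere; Fatou's lemma then applies to [F]. *)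
rewrite ge0_integralTE//; apply: ge_ereal_sup => _ [h /= hf <-].
rewrite -integralT_nnsfun.
pose F x := limn_einf (fun n => `|s n x|%:E).
have mF : measurable_fun setT F .
  apply: (emeasurable_fun_cvg (fun n x => einfs (fun m => `|s m x|%:E) n)).
    by move=> n; exact: measurable_fun_einfs.
  by move=> x _; rewrite /F limn_einf_lim; exact: is_cvg_einfs.
have F0 x : (0 <= F x)%E.
  rewrite /F limn_einf_lim; apply: lime_ge; first exact: is_cvg_einfs.
  by apply: nearW => n; apply: le_ereal_inf_tmp => _ [m /= _ <-].
apply: (@le_trans _ _ (\int[mu]_x F x)%E).
  apply: ae_ge0_le_integral => //.
  - by move=> x _; rewrite lee_fin fun_ge0.
  - by apply/measurable_EFinP; exact: measurable_funTS.
  case: sf => A [mA A0 sA]; exists A; split => //.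
  apply: subset_trans sA; apply: subsetC => x /= sx _.
  rewrite /F.
  have /cvg_limn_einf_sup[-> _] : `|s n x|%:E @[n --> \oo] --> `|f x|%:E.
    by apply: cvg_EFin; [exact: nearW|exact: cvg_norm sx].
  exact: hf.
apply: le_trans (fatou _ _ _ _) _ => //.
rewrite limn_einf_lim; apply: lime_le; first exact: is_cvg_einfs.
apply: nearW => n; apply: le_trans (sM n).
by apply: ereal_inf_lbound; exists n => /=.
Qed.
End oH_integrable_L_space.

Theorem theorem15 (R : realType) (T : pmetricType R)
    (mu : {finite_measure set (borel T) -> \bar R})
    (X : banachLatticeType R) (f : T -> X)
    (compactT : compact [set: T])
    (regular_mu : regular_measure mu)
    (nonatomic_mu : nonatomic mu)
    (order_continuous_X : order_continuous_norm X)
    (oH_integrable_f : oH_integrable mu f)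
    (L_space_X : L_space X) :
  Bochner_integrable mu f.
Proof. exact: oH_integrable_Bochner. Qed.
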